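(* Fix $\varepsilon\in(0,\frac12)$ and $\delta\in(0,\frac12)$, and let $m\ge1$. There exist absolute constants $c_1,c_2>0$ and an integer $p_0=p_0(\varepsilon,\delta)$ such that for all $p\ge p_0$ the following hold. For every $n\le (p-1)(\log\frac1\varepsilon-1)$ and every (possibly randomized) label-permutation-equivariant learner $\mathcal{A}$, with $\widehat f=\mathcal{A}(S)$ for $S=\{(X_i,f(X_i))\}_{i=1}^n$, $X_i$ i.i.d. $\sim\mathcal{D}_X$, \[ \mathbb{P}\big[L(\widehat f)\le\varepsilon\big]\ \le\ \exp\!\Big(-\frac{(e-1)^2}{2\log(1/\varepsilon)}\varepsilon^2p\Big)+\exp(-c_1\varepsilon p)+\exp\!\Big(-\frac{c_2\varepsilon^2p}{\log(1/\varepsilon)}\Big), \] and this right-hand side is at most $\delta$. Consequently, every label-permutation-equivariant learner that, with probability at least $1-\delta$ over $S$ and its internal randomness, achieves $L(\widehat f)\le\varepsilon$ must use $n\ge (p-1)(\log\frac1\varepsilon-1)=\Omega(p)$ samples.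
   Context: Let $[p]=\{0,\dots,p-1\}$, $e_r$ the standard basis of $\mathbb{R}^p$, $\mathcal{X}_m=\{x\in\{0,\dots,m\}^p:\|x\|_1=m\}$, and $\mathcal{D}_X$ the law of $X=\sum_{i=1}^m e_{s_i}$ with $s_1,\dots,s_m$ i.i.d. uniform on $[p]$. The ground-truth rule is $f(x)=(\sum_{k\in[p]}k\,x_k)\bmod p$. A (possibly randomized) learning algorithm $\mathcal{A}$ maps a sample $\{(x^{(i)},y^{(i)})\}_{i=1}^n\in(\mathcal{X}_m\times[p])^n$ to a (distribution over) hypothesis $\mathcal{X}_m\to[p]$. $\mathcal{A}$ is label-permutation equivariant if for every sample and every permutation $\sigma$ of $[p]$, $\mathcal{A}(\{(x^{(i)},\sigma(y^{(i)}))\})=\sigma\circ\mathcal{A}(\{(x^{(i)},y^{(i)})\})$ (equality in distribution of the output functions for randomized $\mathcal{A}$). The risk is $L(\widehat f)=\mathbb{P}_{X\sim\mathcal{D}_X}[\widehat f(X)\ne f(X)]$ with $X$ independent of the sample; the outer probability is over the sample and the internal randomness of $\mathcal{A}$. $\log$ is the natural logarithm. *)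

(* Defs.v *)
From HB Require Import structures.
From mathcomp Require Import all_boot all_order all_algebra all_fingroup.
From mathcomp Require Import all_classical all_reals all_analysis.
Set Implicit Arguments. Unset Strict Implicit. Unset Printing Implicit Defensive.
Import Order.TTheory GRing.Theory Num.Theory.
Local Open Scope ring_scope.

Definition Xm (p m : nat) :=
  {x : {ffun 'I_p -> 'I_m.+1} | (\sum_(k < p) (x k : nat))%N == m}.

Definition truth (p m : nat) (hp : (0 < p)%N) (x : Xm p m) : 'I_p :=
  Ordinal (ltn_pmod (\sum_(k < p) (k * val x k))%N hp).

Definition counts_to (p m : nat) (s : {ffun 'I_m -> 'I_p}) (x : Xm p m) : bool :=
  [forall k : 'I_p, (val x k : nat) == #|[set i | s i == k]|].

(* D_X : law of X = sum_{i=1}^m e_{s_i}, s_i iid uniform on [p] *)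
Definition DX (R : realType) (p m : nat) (x : Xm p m) : R :=
  #|[set s : {ffun 'I_m -> 'I_p} | counts_to s x]|%:R / (p ^ m)%:R.

Definition Hyp (p m : nat) := {ffun Xm p m -> 'I_p}.
Definition Sample (p m n : nat) := {ffun 'I_n -> (Xm p m * 'I_p)%type}.

Definition learner (R : realType) (p m n : nat) (A : Sample p m n -> Hyp p m -> R) :=
  (forall S h, 0 <= A S h) /\ (forall S, \sum_(h : Hyp p m) A S h = 1).

Definition relabel (p m n : nat) (s : {perm 'I_p}) (S : Sample p m n) : Sample p m n :=
  [ffun i => ((S i).1, s (S i).2)].

Definition permh (p m : nat) (s : {perm 'I_p}) (h : Hyp p m) : Hyp p m :=
  [ffun x => s (h x)].

Definition equivariant (R : realType) (p m n : nat) (A : Sample p m n -> Hyp p m -> R) :=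
  forall (S : Sample p m n) (s : {perm 'I_p}) (h : Hyp p m),
    A (relabel s S) (permh s h) = A S h.

Definition risk (R : realType) (p m : nat) (hp : (0 < p)%N) (h : Hyp p m) : R :=
  \sum_(x : Xm p m) DX R x * ((h x != truth hp x) : bool)%:R.

Definition mkSample (p m n : nat) (hp : (0 < p)%N) (xs : {ffun 'I_n -> Xm p m})
  : Sample p m n := [ffun i => (xs i, truth hp (xs i))].

Definition Psucc (R : realType) (p m n : nat) (hp : (0 < p)%N)
  (A : Sample p m n -> Hyp p m -> R) (eps : R) : R :=
  \sum_(xs : {ffun 'I_n -> Xm p m})
    (\prod_(i < n) DX R (xs i)) *
    \sum_(h : Hyp p m) A (mkSample hp xs) h * ((risk R hp h <= eps)%R : bool)%:R.

(* Main.v *)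
Require Import Defs.
From HB Require Import structures.
From mathcomp Require Import all_boot all_order all_algebra all_fingroup.
From mathcomp Require Import all_classical all_reals all_analysis.
From mathcomp Require Import ring lra.
Set Implicit Arguments.
Unset Strict Implicit.
Unset Printing Implicit Defensive.
Import Order.TTheory GRing.Theory Num.Theory.
Local Open Scope ring_scope.

(** Labels of the sample are i.i.d. uniform, and an equivariant learner treats all
    unseen labels alike. Swapping two unseen labels [u], [v] in the hypothesis does
    not change its probability, so on average over the swap the hypothesis labels
    at most half of the inputs of label [u] or [v] correctly. Doing this on disjoint
    pairs bounds an exponential moment of the agreement with the truth on the [N]
    unseen labels, so that given the inputs success has probability at most
    [C * t ^ (eps p) * w ^ N] with explicit [t > 1 > w]. Finally [E (w ^ N)] is at
    most [exp (- (1 - w) r p)] where [r = (1 - 1/p) ^ n >= e eps], by adding the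
    sample points one at a time. Since [e / 2 > 1] the product decays like
    [exp (- c1 eps p)]. *)

(** * Tuples and the multinomial law of the inputs *)

Definition ffun_cons (T : Type) (n : nat) (a : T) (g : {ffun 'I_n -> T}) :
  {ffun 'I_n.+1 -> T} := [ffun i => oapp g a (unlift ord0 i)].

Lemma ffun_cons0 (T : Type) n (a : T) (g : {ffun 'I_n -> T}) :
  ffun_cons a g ord0 = a.
Proof. by rewrite ffunE unlift_none. Qed.

Lemma ffun_consS (T : Type) n (a : T) (g : {ffun 'I_n -> T}) i :
  ffun_cons a g (lift ord0 i) = g i.
Proof. by rewrite ffunE liftK. Qed.

Lemma sum_ffun_cons (V : nmodType) (T : finType) n (F : {ffun 'I_n.+1 -> T} -> V) :
  \sum_f F f = \sum_a \sum_(g : {ffun 'I_n -> T}) F (ffun_cons a g).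
Proof.
rewrite pair_big (reindex (fun q : T * {ffun 'I_n -> T} => ffun_cons q.1 q.2)) //=.
exists (fun f : {ffun 'I_n.+1 -> T} => (f ord0, [ffun i => f (lift ord0 i)])).
  move=> [a g] _ /=; rewrite ffun_cons0; congr pair.
  by apply/ffunP => i; rewrite ffunE ffun_consS.
move=> f _ /=; apply/ffunP => i; case: (unliftP ord0 i) => [j|] ->.
  by rewrite ffun_consS ffunE.
by rewrite ffun_cons0.
Qed.

Lemma sum_fiber (p m : nat) (s : {ffun 'I_m -> 'I_p}) (c : 'I_p -> nat) :
  (\sum_k c k * #|[set i | s i == k]| = \sum_i c (s i))%N.
Proof.
under eq_bigr => k _ do rewrite -sum1_card big_distrr /=.
under eq_bigr => k _ do under eq_bigl => i do rewrite inE.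
rewrite (exchange_big_dep predT) //=; apply: eq_bigr => i _.
by rewrite (big_pred1 (s i)) ?muln1 // => k; rewrite eq_sym.
Qed.

Lemma card_fiber_lt (p m : nat) (s : {ffun 'I_m -> 'I_p}) (k : 'I_p) :
  (#|[set i | s i == k]| < m.+1)%N.
Proof. by rewrite ltnS -[X in (_ <= X)%N]card_ord max_card. Qed.

Lemma count_vec_subproof (p m : nat) (s : {ffun 'I_m -> 'I_p}) :
  (\sum_(k < p) [ffun k => Ordinal (card_fiber_lt s k)] k == m)%N.
Proof.
under eq_bigr => k _ do rewrite ffunE /= -[#|_|]mul1n.
by rewrite (sum_fiber s (fun=> 1%N)) sum1_card card_ord.
Qed.

Definition count_vec (p m : nat) (s : {ffun 'I_m -> 'I_p}) : Xm p m :=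
  Sub [ffun k => Ordinal (card_fiber_lt s k)] (count_vec_subproof s).

Lemma counts_toE (p m : nat) (s : {ffun 'I_m -> 'I_p}) (x : Xm p m) :
  counts_to s x = (x == count_vec s).
Proof.
apply/forallP/eqP => [h|-> k]; last by rewrite /= ffunE.
apply/val_inj/ffunP => k; apply/val_inj; rewrite /= ffunE /=; exact/eqP/h.
Qed.

(** Every draw sequence has exactly one count vector, so the sets counted by [DX] partition the
    sequences. *)
Lemma sum_DX (R : realType) (p m : nat) (G : Xm p m -> R) :
  \sum_x DX R x * G x = (\sum_(s : {ffun 'I_m -> 'I_p}) G (count_vec s)) / (p ^ m)%:R.
Proof.
rewrite mulr_suml.
have -> : \sum_x DX R x * G x = \sum_x \sum_(s : {ffun 'I_m -> 'I_p} | x == count_vec s)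
    G x / (p ^ m)%:R.
  apply: eq_bigr => x _; rewrite /DX -sum1_card natr_sum -mulrA mulr_suml.
  by apply: eq_big => s; rewrite ?inE ?counts_toE // => _; rewrite mul1r mulrC.
rewrite (exchange_big_dep predT) //=; apply: eq_bigr => s _.
by rewrite big_pred1_eq.
Qed.

Lemma truth_count_vec (p m : nat) (hp : (0 < p)%N) (s : {ffun 'I_m -> 'I_p}) :
  truth hp (count_vec s) = ((\sum_i s i) %% p)%N :> nat.
Proof.
rewrite /= -(sum_fiber s (fun k => k : nat)); congr (_ %% _)%N.
by apply: eq_bigr => k _; rewrite ffunE.
Qed.

Lemma DX_ge0 (R : realType) (p m : nat) (x : Xm p m) : 0 <= DX R x.
Proof. by rewrite /DX divr_ge0. Qed.

(** * Uniformity of the label *)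

Lemma card_shift_eq (p a : nat) (hp : (0 < p)%N) (u : 'I_p) :
  (\sum_(k < p) ((k + a) %% p == u) = 1)%N.
Proof.
have a_lt : (a %% p <= p)%N by rewrite ltnW // ltn_pmod.
have aN : ((p - a %% p + a) %% p = 0)%N by rewrite -modnDmr subnK ?modnn.
(* [k0] is [u - a] modulo [p], with [p - a %% p] in place of a negative number. *)
pose k0 := Ordinal (ltn_pmod (u + (p - a %% p)) hp).
rewrite (bigD1 k0) //= big1 ?addn0.
  by rewrite modnDml -addnA -modnDmr aN addn0 modn_small ?eqxx.
move=> k; apply: contraNeq; rewrite eqb0 negbK => /eqP ku; apply/eqP/val_inj; rewrite /= -ku.
by rewrite modnDml -addnA [(a + _)%N]addnC -modnDmr aN addn0 modn_small.
Qed.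

(* Conditionally on all the other draws, the first draw makes the label uniform. *)
Lemma prob_label (R : realType) (p m : nat) (hp : (0 < p)%N) (u : 'I_p) : (0 < m)%N ->
  \sum_(x : Xm p m) DX R x * (truth hp x == u)%:R = p%:R^-1.
Proof.
case: m => // m _; rewrite sum_DX sum_ffun_cons exchange_big /=.
have -> : \sum_(g : {ffun 'I_m -> 'I_p}) \sum_(a < p)
    (truth hp (count_vec (ffun_cons a g)) == u)%:R = (p ^ m)%:R :> R.
  rewrite (eq_bigr (fun=> 1)).
    by rewrite sumr_const card_ffun !card_ord.
  move=> g _; apply: etrans (congr1 (fun k => k%:R) (card_shift_eq (\sum_i g i)%N hp u)).
  rewrite natr_sum; apply: eq_bigr => a _.
  rewrite -(inj_eq (@ord_inj p)) truth_count_vec big_ord_recl ffun_cons0.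
  by rewrite (eq_bigr (fun i => g i : nat)) // => i _; congr nat_of_ord; exact: ffun_consS.
by rewrite expnS natrM invfM mulrCA divff ?mulr1 // pnatr_eq0 -lt0n expn_gt0 hp.
Qed.

(** * Agreement of a hypothesis with the truth *)

(** For [0 < m] this is the conditional probability of output [v] given true label [u], since labels
    have probability [1/p]. *)
Definition agree (R : realType) (p m : nat) (hp : (0 < p)%N) (h : Hyp p m)
    (u v : 'I_p) : R :=
  p%:R * \sum_x DX R x * ((truth hp x == u) && (h x == v))%:R.

Lemma agree_ge0 (R : realType) (p m : nat) (hp : (0 < p)%N) (h : Hyp p m) u v :
  0 <= agree R hp h u v.
Proof. by rewrite mulr_ge0 // sumr_ge0 // => x _; rewrite mulr_ge0 ?DX_ge0. Qed.

Lemma agree_permh (R : realType) (p m : nat) (hp : (0 < p)%N) (s : {perm 'I_p})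
    (h : Hyp p m) u v :
  agree R hp (permh s h) u (s v) = agree R hp h u v.
Proof.
by congr (_ * _); apply: eq_bigr => x _; rewrite ffunE (inj_eq perm_inj).
Qed.

Lemma prob_labelM (R : realType) (p m : nat) (hp : (0 < p)%N) (u : 'I_p) : (0 < m)%N ->
  p%:R * \sum_(x : Xm p m) DX R x * (truth hp x == u)%:R = 1.
Proof. by move=> hm; rewrite prob_label // divff // pnatr_eq0 -lt0n. Qed.

Lemma agree_pair (R : realType) (p m : nat) (hp : (0 < p)%N) (h : Hyp p m) u v w :
  (0 < m)%N -> v != w -> agree R hp h u v + agree R hp h u w <= 1.
Proof.
move=> hm vw; rewrite -(prob_labelM R hp u hm) -mulrDr ler_wpM2l // -big_split /=.
apply: ler_sum => x _; rewrite -mulrDr ler_wpM2l ?DX_ge0 // -natrD ler_nat.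
case: (truth hp x == u) => //=; have [->|//] := eqVneq (h x) v.
  by rewrite (negPf vw).
by rewrite add0n leq_b1.
Qed.

(** [1 - agree u u] is the conditional error on label [u], and a misclassified input has its true
    label at most once in the duplicate-free [l]. *)
Lemma risk_agree (R : realType) (p m : nat) (hp : (0 < p)%N) (h : Hyp p m)
    (l : seq 'I_p) : (0 < m)%N -> uniq l ->
  (size l)%:R - \sum_(u <- l) agree R hp h u u <= p%:R * risk R hp h.
Proof.
move=> hm lu; rewrite -sum1_size natr_sum -sumrB.
under eq_bigr => u _ do rewrite -[1%:R](prob_labelM R hp u hm) -mulrBr -sumrB.
rewrite -mulr_sumr ler_wpM2l // exchange_big /=; apply: ler_sum => x _.
under eq_bigr => u _ do rewrite -mulrBr.
rewrite -mulr_sumr ler_wpM2l ?DX_ge0 //.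
have [hx|hx] := eqVneq (h x) (truth hp x).
  rewrite big1 // => u _; rewrite hx; case: eqP => //= _; exact: subrr.
apply: (@le_trans _ _ (\sum_(u <- l) (truth hp x == u)%:R)).
  by apply: ler_sum => u _; rewrite gerBl.
rewrite -natr_sum (eq_bigr (fun u => (u == truth hp x) : nat)); last first.
  by move=> u _; rewrite eq_sym.
by rewrite -big_mkcond sum1_count -/(count_mem _ _) count_uniq_mem // ler_nat leq_b1.
Qed.

(** * Exponential moment of the agreement *)

Lemma expR_chord (R : realType) (lam x : R) : 0 <= x <= 2 ->
  expR (lam * x) <= 1 + (expR (lam * 2) - 1) * (x / 2).
Proof.
move=> /andP[x0 x2].
have t0 : 0 <= x / 2 by rewrite divr_ge0.
have t1 : x / 2 <= 1 by rewrite ler_pdivrMr ?mul1r.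
have : expR (x / 2 * (lam * 2) + (1 - x / 2) * 0) <=
    x / 2 * expR (lam * 2) + (1 - x / 2) * expR 0 := convex_expR (Itv01 t0 t1) (lam * 2) 0.
rewrite expR0 mulr0 addr0 mulr1.
have -> : x / 2 * (lam * 2) = lam * x by field.
by move=> h; apply: le_trans h _; lra.
Qed.

(** Adding the two chord bounds leaves an expression increasing in [x + y], hence largest at
    [x + y = 2]. *)
Lemma expR_pair (R : realType) (lam x y : R) : 0 <= lam -> 0 <= x -> 0 <= y ->
  x + y <= 2 -> expR (lam * x) + expR (lam * y) <= expR (lam * 2) + 1.
Proof.
move=> l0 x0 y0 xy.
have hx : 0 <= x <= 2 by lra.
have hy : 0 <= y <= 2 by lra.
apply: le_trans (lerD (expR_chord lam hx) (expR_chord lam hy)) _.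
have l2 : 1 <= expR (lam * 2) by rewrite -expR0 ler_expR mulr_ge0.
by nra.
Qed.

(* Averaging over [h] and its image under the transposition of [u] and [v], convexity
   of [exp] gives a factor [g ^+ 2] for each pair of labels removed from [l]. *)
Lemma agree_moment (R : realType) (p m : nat) (hp : (0 < p)%N) (P : Hyp p m -> R)
    (lam g : R) (l : seq 'I_p) :
  (0 < m)%N -> 0 <= lam -> 1 <= g -> expR (lam * 2) + 1 <= 2 * g ^+ 2 ->
  (forall h, 0 <= P h) -> \sum_h P h = 1 -> uniq l ->
  {in l &, forall u v h, P (permh (tperm u v) h) = P h} ->
  \sum_h P h * expR (lam * \sum_(u <- l) agree R hp h u u) <= expR lam * g ^+ size l.
Proof.
move=> hm l0 g1 hg P0 P1.
have g0 : 0 <= g by apply: le_trans g1.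
have e1 : 1 <= expR lam by rewrite -expR0 ler_expR.
have [n] := ubnP (size l); elim: n l => // n IHn [|u [|v l]] sz lu inv.
- under eq_bigr => h _ do rewrite big_nil mulr0 expR0 mulr1.
  by rewrite P1 mulr1.
(* A leftover single label has agreement at most 1; the prefactor [expR lam] pays for it. *)
- rewrite -[expR lam]mul1r -{1}P1 !mulr_suml; apply: ler_sum => h _.
  rewrite -mulrA ler_wpM2l // big_seq1 -[leLHS]mulr1 ler_pM ?expR_ge0 //.
  rewrite ler_expR -[leRHS]mulr1 ler_wpM2l // -(prob_labelM R hp u hm).
  rewrite ler_wpM2l // ler_sum // => x _; rewrite ler_wpM2l ?DX_ge0 // ler_nat.
  by case: (truth hp x == u) => //=; exact: leq_b1.
have [uv ul vl lu'] : [/\ u != v, u \notin l, v \notin l & uniq l].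
  by move: lu; rewrite /= inE negb_or -!andbA => /and4P[].
pose s := tperm u v.
pose F (h : Hyp p m) := P h * expR (lam * \sum_(w <- l) agree R hp h w w).
pose a (h : Hyp p m) := expR (lam * (agree R hp h u u + agree R hp h v v)).
have sK : involutive (@permh p m s).
  by move=> h; apply/ffunP => x; rewrite !ffunE tpermK.
(* [F] involves only labels other than [u] and [v], which the transposition fixes. *)
have Fs h : F (permh s h) = F h.
  rewrite /F inv ?inE ?eqxx ?orbT //; congr (_ * expR (_ * _)).
  apply: eq_big_seq => w wl; have := agree_permh R hp s h w w.
  by rewrite tpermD //; apply: contraTneq wl => <-.
have F0 h : 0 <= F h by rewrite mulr_ge0 ?expR_ge0.
have -> : \sum_h P h * expR (lam * \sum_(w <- [:: u, v & l]) agree R hp h w w) =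
    \sum_h F h * a h.
  apply: eq_bigr => h _; rewrite !big_cons addrA mulrDr expRD -mulrA; congr (_ * _).
  exact: mulrC.
have Ea : \sum_h F h * a h = \sum_h F h * a (permh s h).
  by rewrite (reindex_inj (inv_inj sK)) /=; under eq_bigr => h _ do rewrite Fs.
have aa h : a h + a (permh s h) <= 2 * g ^+ 2.
  apply: le_trans hg; apply: expR_pair; rewrite ?addr_ge0 ?agree_ge0 //.
  have := agree_permh R hp s h u v; rewrite tpermR => ->.
  have := agree_permh R hp s h v u; rewrite tpermL => ->.
  rewrite addrACA -[_ + agree R hp h v u]addrC.
  by apply: lerD; apply: agree_pair; rewrite // eq_sym.
have aF : \sum_h F h * a h <= (\sum_h F h) * g ^+ 2.
  rewrite -(ler_pM2l (ltr0n R 2)) mulrDl !mul1r {2}Ea -big_split /= mulrCA mulr_suml.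
  by apply: ler_sum => h _; rewrite -mulrDr ler_wpM2l.
apply: le_trans aF _; rewrite /= -[(size l).+2]addn2 exprD mulrA ler_wpM2r ?exprn_ge0 //.
apply: (IHn l _ lu'); first by move: sz; rewrite /= ltnS => /ltnW.
by move=> x y xl yl; apply: inv; rewrite !inE ?xl ?yl !orbT.
Qed.

(** * Unseen labels and their number *)

(** The set [V] is a parameter so that an induction on the sample can delete labels from it. *)
Definition unseen (p m n : nat) (hp : (0 < p)%N) (V : {set 'I_p})
    (xs : {ffun 'I_n -> Xm p m}) : {set 'I_p} :=
  [set u in V | [forall i, truth hp (xs i) != u]].

(** A Chernoff bound: risk at most [eps] forces total agreement at least [#|U| - eps p] on the
    unseen set [U], so an exponential dominates the indicator of success. *)
Lemma success_given_inputs (R : realType) (p m n : nat) (hp : (0 < p)%N)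
    (A : Sample p m n -> Hyp p m -> R) (eps lam g : R) (xs : {ffun 'I_n -> Xm p m}) :
  (0 < m)%N -> 0 <= lam -> 1 <= g -> expR (lam * 2) + 1 <= 2 * g ^+ 2 ->
  learner A -> equivariant A ->
  \sum_h A (mkSample hp xs) h * ((risk R hp h <= eps)%R : bool)%:R <=
    expR (lam * (1 + eps * p%:R)) * (g * expR (- lam)) ^+ #|unseen hp [set: 'I_p] xs|.
Proof.
move=> hm l0 g1 hg [A0 A1] eqA; set U := unseen _ _ _.
(* Transposing two unseen labels leaves the sample unchanged, so equivariance becomes invariance of
   the output law. *)
have inv : {in enum U &, forall u v h,
    A (mkSample hp xs) (permh (tperm u v) h) = A (mkSample hp xs) h}.
  move=> u v; rewrite !mem_enum !inE /= => /forallP xu /forallP xv h.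
  rewrite -[RHS](eqA _ (tperm u v)); congr A; apply/ffunP => i; rewrite !ffunE /=.
  by rewrite tpermD // eq_sym.
have := agree_moment hp hm l0 g1 hg (A0 _) (A1 _) (enum_uniq U) inv; rewrite -cardE => mom.
pose c := expR (lam * (eps * p%:R - #|U|%:R)).
apply: (@le_trans _ _ (\sum_h A (mkSample hp xs) h *
    expR (lam * \sum_(u <- enum U) agree R hp h u u) * c)).
  apply: ler_sum => h _; rewrite -mulrA ler_wpM2l // -expRD -mulrDr.
  case: (lerP (risk R hp h) eps) => hr; last exact: expR_ge0.
  rewrite -[1%:R]expR0 ler_expR mulr_ge0 //.
  have := risk_agree R hp h hm (enum_uniq U); rewrite -cardE.
  have : p%:R * risk R hp h <= p%:R * eps by rewrite ler_wpM2l.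
  lra.
rewrite -mulr_suml; apply: (@le_trans _ _ (expR lam * g ^+ #|U| * c)).
  by rewrite ler_wpM2r ?expR_ge0.
rewrite exprMn -expRM_natr mulrA -[expR lam * _]mulrC -[expR _ * g ^+ _]mulrC -!mulrA.
rewrite ler_wpM2l ?exprn_ge0 ?(le_trans _ g1) // -!expRD ler_expR; lra.
Qed.

Lemma sum_DX_label (R : realType) (p m : nat) (hp : (0 < p)%N) (G : 'I_p -> R) :
  (0 < m)%N -> \sum_(x : Xm p m) DX R x * G (truth hp x) = p%:R^-1 * \sum_u G u.
Proof.
move=> hm; rewrite mulr_sumr.
under [RHS]eq_bigr => u _ do rewrite -(prob_label R hp u hm) mulr_suml.
rewrite exchange_big /=; apply: eq_bigr => x _.
rewrite (bigD1 (truth hp x)) //= eqxx mulr1 big1 ?addr0 // => u.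
by rewrite eq_sym => /negPf ->; rewrite mulr0 mul0r.
Qed.

Lemma unseen0 (p m : nat) (hp : (0 < p)%N) (V : {set 'I_p}) (xs : {ffun 'I_0 -> Xm p m}) :
  unseen hp V xs = V.
Proof. by apply/setP => u; rewrite inE; case: (u \in V) => //=; apply/forallP => -[]. Qed.

Lemma unseen_cons (p m n : nat) (hp : (0 < p)%N) (V : {set 'I_p}) (x : Xm p m)
    (xs : {ffun 'I_n -> Xm p m}) :
  unseen hp V (ffun_cons x xs) = unseen hp (V :\ truth hp x) xs.
Proof.
apply/setP => u; rewrite !inE [u == _]eq_sym -andbA andbCA; congr andb.
apply/forallP/andP => [h|[h1 /forallP h2] i].
  split; first by have := h ord0; rewrite ffun_cons0.
  by apply/forallP => i; have := h (lift ord0 i); rewrite ffun_consS.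
by case: (unliftP ord0 i) => [j|] ->; rewrite ?ffun_cons0 ?ffun_consS.
Qed.

(** The left side is the first two terms of the binomial expansion. *)
Lemma bernoulli_exp (R : realType) (w d : R) (k : nat) : 0 <= w -> 0 <= d ->
  w ^+ k.+1 + k.+1%:R * d * w ^+ k <= (w + d) ^+ k.+1.
Proof.
move=> w0 d0; elim: k => [|k IHk]; first by rewrite expr0 !expr1 mulr1 mul1r.
have wk : 0 <= w ^+ k by rewrite exprn_ge0.
rewrite [leRHS]exprS; apply: (@le_trans _ _ ((w + d) * (w ^+ k.+1 + k.+1%:R * d * w ^+ k))).
  rewrite -[k.+2%:R]nat1r !exprS.
  have : 0 <= k.+1%:R * d * d * w ^+ k by rewrite !mulr_ge0.
  lra.
by rewrite ler_wpM2l // addr_ge0.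
Qed.

Lemma sum_pow_remove (R : realType) (p : nat) (V : {set 'I_p}) (w : R) :
  \sum_u w ^+ #|V :\ u| = #|V|%:R * w ^+ #|V|.-1 + (p%:R - #|V|%:R) * w ^+ #|V|.
Proof.
rewrite (bigID (mem V)) /=; congr (_ + _).
  rewrite (eq_bigr (fun=> w ^+ #|V|.-1)); first by rewrite sumr_const mulr_natl.
  by move=> u uV; rewrite (cardsD1 u V) uV.
rewrite (eq_bigr (fun=> w ^+ #|V|)).
  rewrite sumr_const -natrB; last by rewrite -[X in (_ <= X)%N]card_ord max_card.
  rewrite mulr_natl; congr (_ *+ _).
  have := cardsC V; rewrite card_ord => /(congr1 (subn^~ #|V|)); rewrite addKn => <-.
  by apply: eq_card => u; rewrite !inE.
by move=> u uV; rewrite (cardsD1 u V) (negPf uV).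
Qed.

(** Equality would hold if the labels of [V] were unseen independently, each with probability
    [(1 - 1/p) ^ n]; their negative dependence gives the inequality. *)
Lemma mean_pow_unseen (R : realType) (p m n : nat) (hp : (0 < p)%N) (V : {set 'I_p}) (w : R) :
  (0 < m)%N -> 0 <= w <= 1 ->
  \sum_(xs : {ffun 'I_n -> Xm p m}) (\prod_i DX R (xs i)) * w ^+ #|unseen hp V xs| <=
    (1 - (1 - w) * (1 - p%:R^-1) ^+ n) ^+ #|V|.
Proof.
move=> hm w01; have pR : 0 < p%:R :> R by rewrite ltr0n.
elim: n V => [|n IHn] V.
  under eq_bigr => xs _ do rewrite big_ord0 unseen0 mul1r.
  by rewrite sumr_const card_ffun card_ord expn0 mulr1n expr0 mulr1 opprB addrC subrK.
set r := _ ^+ n in IHn; rewrite exprS -/r.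
have r01 : 0 <= r <= 1.
  have p1 : p%:R^-1 <= 1 :> R by rewrite invf_le1 // ler1n.
  have p0 : 0 <= p%:R^-1 :> R by rewrite invr_ge0 ltW.
  by rewrite exprn_ge0 ?exprn_ile1 //; lra.
set wn := 1 - (1 - w) * r in IHn.
have wn01 : 0 <= wn <= 1 by rewrite /wn; nra.
rewrite sum_ffun_cons.
apply: (@le_trans _ _ (\sum_(x : Xm p m) DX R x * wn ^+ #|V :\ truth hp x|)).
  apply: ler_sum => x _.
  rewrite (eq_bigr (fun xs : {ffun 'I_n -> Xm p m} => DX R x * ((\prod_i DX R (xs i)) *
      w ^+ #|unseen hp (V :\ truth hp x) xs|))).
    by rewrite -mulr_sumr ler_wpM2l ?DX_ge0.
  move=> xs _; rewrite unseen_cons big_ord_recl ffun_cons0 mulrA; congr (_ * _ * _).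
  by apply: eq_bigr => i _; rewrite ffun_consS.
rewrite (sum_DX_label hp (fun u => wn ^+ #|V :\ u|)) // sum_pow_remove.
(* One more point raises the base by [(1 - wn) / p]; with this increment the lower bound of
   [bernoulli_exp] is exactly the average at hand. *)
have -> : 1 - (1 - w) * ((1 - p%:R^-1) * r) = wn + (1 - wn) / p%:R by rewrite /wn; ring.
case: #|V| => [|k].
  by rewrite mul0r add0r subr0 !expr0 mulr1 mulVf ?gt_eqF.
apply: le_trans (bernoulli_exp k _ _); [|by lra|by rewrite divr_ge0; lra].
rewrite le_eqVlt; apply/orP; left; apply/eqP; rewrite /= exprS; field.
by rewrite gt_eqF.
Qed.

(** * Numerical estimates and conclusion *)

(** The constant is [(5/4) ^ 4]; the final estimate needs more than [e >= 9/4]. *)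
Lemma expR1_ge (R : realType) : 625%:R / 256%:R <= expR 1 :> R.
Proof.
have -> : expR 1 = expR (4^-1 : R) ^+ 4 by rewrite -expRM_natr mulVf.
have -> : 625%:R / 256%:R = (1 + 4^-1) ^+ 4 :> R by field.
by rewrite lerXn2r ?nnegrE ?expR_ge0 ?expR_ge1Dx ?addr_ge0.
Qed.

(** [1 - 1/p] is the inverse of [1 + 1/(p-1)], hence at least [exp (-1/(p-1))]; this is where the
    factor [p - 1] in the sample bound comes from. *)
Lemma pow_unseen_ge (R : realType) (p n : nat) (eps : R) : (2 <= p)%N -> 0 < eps ->
  n%:R <= (p%:R - 1) * (ln eps^-1 - 1) -> expR 1 * eps <= (1 - p%:R^-1) ^+ n.
Proof.
move=> p2 e0 hn; have p1 : 1 < p%:R :> R by rewrite ltr1n.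
have q0 : 0 < p%:R - 1 :> R by rewrite subr_gt0.
have base : expR (- (p%:R - 1)^-1) <= 1 - p%:R^-1 :> R.
  have -> : 1 - p%:R^-1 = (1 + (p%:R - 1)^-1)^-1 :> R.
    by field; rewrite !gt_eqF //; lra.
  by rewrite expRN lef_pV2 ?posrE ?expR_gt0 ?expR_ge1Dx // addr_gt0 ?invr_gt0.
apply: (@le_trans _ _ (expR (- (p%:R - 1)^-1) ^+ n)); last first.
  by rewrite lerXn2r ?nnegrE ?expR_ge0 // (le_trans _ base) ?expR_ge0.
rewrite -expRM_natr -{1}[eps]lnK ?posrE // -expRD ler_expR.
have : n%:R / (p%:R - 1) <= ln eps^-1 - 1 by rewrite ler_pdivrMr // mulrC.
by rewrite lnV ?posrE // mulNr [_^-1 * _]mulrC; lra.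
Qed.

Lemma expR_le_eventually (R : realType) (k d : R) : 0 < k -> 0 < d ->
  exists N : nat, forall p : nat, (N <= p)%N -> expR (- (k * p%:R)) <= d.
Proof.
move=> k0 d0; exists (Num.bound (k * d)^-1) => p Np.
have kd : 0 < k * d by rewrite mulr_gt0.
have hp : (k * d)^-1 <= p%:R.
  apply: ltW; apply: lt_le_trans (archi_boundP _) _; first by rewrite invr_ge0 ltW.
  by rewrite ler_nat.
rewrite expRN -[d]invrK lef_pV2 ?posrE ?expR_gt0 ?invr_gt0 //.
apply: le_trans _ (expR_ge1Dx _); move: hp; rewrite invfM mulrC ler_pdivrMr // mulrC.
lra.
Qed.

(* [w] is a rational just above [sqrt ((1 + (9/10)^2) / 2)], so that [agree_moment]
   applies with [expR lam = 10 / 9] and [g = 10 / 9 * w]; what the final estimate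
   needs is [lam < e * (1 - w)]. *)
Lemma success_bound (R : realType) (p m n : nat) (hp : (0 < p)%N)
    (A : Sample p m n -> Hyp p m -> R) (eps : R) :
  (0 < m)%N -> (2 <= p)%N -> 0 < eps -> 56 <= eps * p%:R ->
  n%:R <= (p%:R - 1) * (ln eps^-1 - 1) -> learner A -> equivariant A ->
  Psucc hp A eps <= expR (- (200^-1 * eps * p%:R)).
Proof.
move=> hm p2 e0 ep hn lA eqA.
pose lam : R := ln (10 / 9); pose w : R := 1903 / 2000; pose g : R := 10 / 9 * w.
have elam : expR lam = 10 / 9 by rewrite lnK // posrE; lra.
have l0 : 0 <= lam by apply: ln_ge0; lra.
have l9 : lam <= 9^-1.
  have -> : lam = ln (1 + 9^-1) by congr ln; field.
  by apply: le_ln1Dx; lra.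
have gl : g * expR (- lam) = w by rewrite expRN elam /g; field.
have step : Psucc hp A eps <= expR (lam * (1 + eps * p%:R)) *
    \sum_(xs : {ffun 'I_n -> Xm p m}) (\prod_i DX R (xs i)) *
      w ^+ #|unseen hp [set: 'I_p] xs|.
  rewrite mulr_sumr; apply: ler_sum => xs _; rewrite mulrCA -gl.
  rewrite ler_wpM2l ?prodr_ge0 // => [i _|]; first exact: DX_ge0.
  apply: success_given_inputs => //; first by rewrite /g /w; lra.
  by rewrite expRM_natr elam /g /w; lra.
apply: le_trans step _.
have w01 : 0 <= w <= 1 by rewrite /w; lra.
pose r : R := (1 - p%:R^-1) ^+ n.
have r_ge : 625%:R / 256%:R * eps <= r.
  apply: le_trans (pow_unseen_ge p2 e0 hn).
  by rewrite ler_wpM2r ?expR1_ge // ltW.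
have r_le : r <= 1.
  have pR : 1 <= p%:R :> R by rewrite ler1n.
  have p1 : p%:R^-1 <= 1 :> R by rewrite invf_le1 // ltr0n.
  have p0 : 0 <= p%:R^-1 :> R by rewrite invr_ge0.
  by rewrite exprn_ile1 //; lra.
apply: (@le_trans _ _ (expR (lam * (1 + eps * p%:R)) * expR (- ((1 - w) * r) * p%:R))).
  rewrite ler_wpM2l ?expR_ge0 //.
  apply: le_trans (mean_pow_unseen n hp [set: 'I_p] hm w01) _.
  rewrite cardsT card_ord expRM_natr lerXn2r ?nnegrE ?expR_ge0 ?expR_ge1Dx //.
  by rewrite -/r /w; lra.
rewrite -expRD ler_expR.
have h1 : lam * (1 + eps * p%:R) <= 9^-1 * (1 + eps * p%:R).
  by rewrite ler_wpM2r // addr_ge0 // (le_trans _ ep).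
have h2 : 625%:R / 256%:R * eps * p%:R <= r * p%:R by rewrite ler_wpM2r.
(* [97/2000 * 625/256] exceeds [1/9 + 1/200] by more than [1/500], and [56/500] covers the constant
   [1/9]. *)
rewrite /w; lra.
Qed.

Theorem mainTheorem8 (R : realType) :
  exists c1 c2 : R, 0 < c1 /\ 0 < c2 /\
  forall eps delta : R, 0 < eps < 2^-1 -> 0 < delta < 2^-1 ->
  exists p0 : nat, forall (m p : nat) (hp : (0 < p)%N),
    (1 <= m)%N -> (p0 <= p)%N ->
    let rhs :=
      expR (- ((expR 1 - 1) ^+ 2 / (2 * ln eps^-1)) * eps ^+ 2 * p%:R)
      + expR (- (c1 * eps * p%:R))
      + expR (- (c2 * eps ^+ 2 * p%:R / ln eps^-1)) in
    [/\ forall (n : nat) (A : Sample p m n -> Hyp p m -> R),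
          n%:R <= (p%:R - 1) * (ln eps^-1 - 1) ->
          learner A -> equivariant A ->
          Psucc hp A eps <= rhs,
        rhs <= delta &
        forall (n : nat) (A : Sample p m n -> Hyp p m -> R),
          learner A -> equivariant A ->
          1 - delta <= Psucc hp A eps ->
          (p%:R - 1) * (ln eps^-1 - 1) <= n%:R].
Proof.
(* [c1] is the rate of [success_bound]; [c2] only has to be positive for its term to tend to 0. *)
exists 200^-1, 1; split; first by rewrite invr_gt0.
split=> // eps delta /andP[e0 e2] /andP[d0 d2].
have L0 : 0 < ln eps^-1.
  by rewrite ln_gt0 // invf_gt1 //; lra.
have d3 : 0 < delta / 3 by lra.
have ne : 0 < (expR 1 - 1) ^+ 2 :> R.
  by rewrite exprn_gt0 // subr_gt0 expR_gt1.
have k1 : 0 < (expR 1 - 1) ^+ 2 / (2 * ln eps^-1) * eps ^+ 2.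
  by rewrite mulr_gt0 ?exprn_gt0 // divr_gt0 // mulr_gt0.
have k2 : 0 < 200^-1 * eps by rewrite mulr_gt0 ?invr_gt0.
have k3 : 0 < eps ^+ 2 / ln eps^-1 by rewrite divr_gt0 ?exprn_gt0.
have [N1 h1] := expR_le_eventually k1 d3.
have [N2 h2] := expR_le_eventually k2 d3.
have [N3 h3] := expR_le_eventually k3 d3.
pose N4 := Num.bound (56 / eps).
(* [N1], [N2], [N3] bring each exponential below [delta / 3]; [N4] ensures [eps p >= 56]. *)
exists (maxn 2 (maxn (maxn N1 N2) (maxn N3 N4))) => m p hp hm.
rewrite !geq_max => /and3P[p2 /andP[p1 p2'] /andP[p3 p4]] rhs.
have ep : 56 <= eps * p%:R.
  rewrite mulrC -ler_pdivrMr //; apply: ltW; apply: lt_le_trans (archi_boundP _) _.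
    by rewrite divr_ge0 // ltW.
  by rewrite ler_nat.
have bound n (A : Sample p m n -> Hyp p m -> R) :
    n%:R <= (p%:R - 1) * (ln eps^-1 - 1) -> learner A -> equivariant A ->
    Psucc hp A eps <= rhs.
  move=> hn lA eqA; apply: le_trans (success_bound hp hm p2 e0 ep hn lA eqA) _.
  by rewrite /rhs addrAC lerDr addr_ge0 ?expR_ge0.
have small : rhs <= delta.
  have -> : delta = delta / 3 + delta / 3 + delta / 3 by field.
  rewrite /rhs; apply: lerD; first apply: lerD.
  - by rewrite !mulNr h1.
  - exact: h2.
  - by rewrite mul1r mulrAC h3.
split=> // n A lA eqA hs.
(* Fewer samples would give [1 - delta <= delta], against [delta < 1/2]. *)
rewrite leNgt; apply/negP => /ltW hn.
have := bound n A hn lA eqA; lra.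
Qed.
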